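(* Let $K\subset\mathbb{R}^n$ be a convex body and let $\mathbf{1}_K$ be its characteristic function. Then the super-level set $\{x\in\mathbb{R}^n: L(\mathbf{1}_K)(x)\ge 1\}$ of the Löwner function $L(\mathbf{1}_K)$ is exactly the Löwner ellipsoid of $K$.
   Context: A convex body is a compact convex set with nonempty interior. The Löwner ellipsoid of $K$ is the unique ellipsoid of minimal volume containing $K$. A log-concave function is $f=e^{-\psi}$ with $\psi:\mathbb{R}^n\to\mathbb{R}\cup\{\infty\}$ convex; it is nondegenerate if $\mathrm{int}(\mathrm{supp} f)\ne\emptyset$. For a nondegenerate integrable log-concave function $f=e^{-\psi}$, the Löwner function is $L(f)(x)=e^{-\|A_0x\|_2+t_0}$, where $(A_0,t_0)$ minimizes $\int_{\mathbb{R}^n}e^{-\|Ax\|_2+t}dx$ over all $t\in\mathbb{R}$ and all invertible affine maps $A$ of $\mathbb{R}^n$ subject to $\|Ax\|_2-t\le\psi(x)$ for all $x\in\mathbb{R}^n$ (equivalently $e^{-\|Ax\|_2+t}\ge f(x)$ for all $x$). Such a minimizer exists, $t_0$ is unique and $A_0$ is unique up to left multiplication by an orthogonal matrix, so $L(f)$ is well defined. *)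

(* Defs.v *)
From HB Require Import structures.
From mathcomp Require Import all_boot all_order all_algebra.
From mathcomp Require Import all_classical all_reals all_analysis.
Set Implicit Arguments.
Unset Strict Implicit.
Unset Printing Implicit Defensive.
Import Order.TTheory GRing.Theory Num.Theory.
Import numFieldNormedType.Exports.
Local Open Scope classical_set_scope.
Local Open Scope ring_scope.

(* [lebesgue_measure] lives on the line only.  The n-dimensional one is built
   on n.-tuple R, which carries the product sigma-algebra (here the Borel sets
   of R^n), as the iterated product: Dirac mass at the empty tuple for n = 0,
   then the image of lambda^1 \x lambda^n under (x, v) |-> x :: v. *)
Fixpoint lebesgue_tuple (R : realType) (n : nat) :
    set (n.-tuple (measurableTypeR R)) -> \bar R :=
  match n with
  | 0 => fun A => \d_([tuple] : 0.-tuple (measurableTypeR R)) A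
  | n'.+1 => pushforward
      (product_measure1 (@lebesgue_measure R) (lebesgue_tuple (R := R) (n := n')))
      (fun p => [tuple of p.1 :: p.2])
  end.

Section Loewner.
Variables (R : realType) (n : nat).

(* R^n is 'cV[R]_n; its library topology comes from the max norm, hence is the
   usual one. *)
Local Notation Rn := 'cV[R]_n.

Definition tuple_vec (v : n.-tuple R) : Rn := \col_i tnth v i.

Definition volume (A : set Rn) : \bar R :=
  lebesgue_tuple (tuple_vec @^-1` A).

Definition integral_Rn (f : Rn -> R) : \bar R :=
  (\int[@lebesgue_tuple R n]_v (f (tuple_vec v))%:E)%E.

Definition euclidean_norm (x : Rn) : R := Num.sqrt (\sum_i x i 0 ^+ 2).

Definition convex_body (K : set Rn) : Prop :=
  [/\ convex_set (K : set (convex_lmodType Rn)), compact K & K° !=set0].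

Definition invertible_affine (A : Rn -> Rn) : Prop :=
  exists (M : 'M[R]_n) (b : Rn), M \in unitmx /\ A = (fun x => M *m x + b).

Definition is_ellipsoid (E : set Rn) : Prop :=
  exists2 A, invertible_affine A & E = A @` [set x | euclidean_norm x <= 1].

Definition is_loewner_ellipsoid (K E : set Rn) : Prop :=
  [/\ is_ellipsoid E, K `<=` E &
      forall E', is_ellipsoid E' -> K `<=` E' -> (volume E <= volume E')%E].

(* The ellipsoid of minimal volume containing K exists and is unique for a
   convex body K; set0 is the value when there is none. *)
Definition loewner_ellipsoid (K : set Rn) : set Rn :=
  xget set0 [set E | is_loewner_ellipsoid K E].

Definition exp_cone (A : Rn -> Rn) (t : R) : Rn -> R :=
  fun x => expR (- euclidean_norm (A x) + t).

(* With f = e^{-psi}, the inequality is ||A x|| - t <= psi x. *)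
Definition loewner_admissible (f : Rn -> R) (A : Rn -> Rn) (t : R) : Prop :=
  invertible_affine A /\ forall x, f x <= exp_cone A t x.

Definition is_loewner_function (f L : Rn -> R) : Prop :=
  exists (A0 : Rn -> Rn) (t0 : R),
    [/\ loewner_admissible f A0 t0,
        (forall A t, loewner_admissible f A t ->
          (integral_Rn (exp_cone A0 t0) <= integral_Rn (exp_cone A t))%E) &
        L = exp_cone A0 t0].

(* Such an L exists and is unique when f is nondegenerate, integrable and
   log-concave; for other f without a minimizer the value is the constant 1. *)
Definition loewner_function (f : Rn -> R) : Rn -> R :=
  xget (cst 1) [set L | is_loewner_function f L].

End Loewner.

(* Main.v *)
From HB Require Import structures.
Require Import Defs.
From mathcomp Require Import all_boot all_order all_algebra.
From mathcomp Require Import all_classical all_reals all_analysis.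
From mathcomp Require Import measurable_realfun ring lra.
Set Implicit Arguments.
Unset Strict Implicit.
Unset Printing Implicit Defensive.
Import Order.TTheory GRing.Theory Num.Theory.
Import numFieldNormedType.Exports.
Local Open Scope classical_set_scope.
Local Open Scope ring_scope.

(* The pair (A, t) is admissible for the indicator of K exactly when K lies in
   the ellipsoid {|A x| <= t}.  If A has linear part M, that ellipsoid has volume
   V = vol(B) t^n / |det M|, and the integral of exp(- |A x| + t) is
   c e^t / |det M|, a multiple of V e^t t^-n.  Since e^t t^-n has its strict
   minimum at t = n, the minimizers are the pairs (n A, n) where {|A x| <= 1} is
   an ellipsoid of minimal volume containing K, that is, where |det M| is maximal
   among the affine maps sending K into the unit ball.  Such maximal maps exist
   by compactness.  For two of them, M1 x + b1 and M2 x + b2, there is an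
   orthogonal Q such that the half sum of M1 and Q M2 has a larger determinant,
   unless M2 M1^-1 is orthogonal; and then a difference between the translation
   parts would leave room for a dilation. *)

(** * Lebesgue measure on tuples: measure structure and slicing *)

Section lebesgue_tuple_measure.
Variable R : realType.
Local Notation T := (measurableTypeR R).
Local Notation leb n := (@lebesgue_tuple R n).

Definition tcons n (p : T * n.-tuple T) : n.+1.-tuple T := [tuple of p.1 :: p.2].

Lemma measurable_tcons n : measurable_fun [set: T * n.-tuple T] (@tcons n).
Proof. exact: measurable_cons. Qed.

Definition tuncons n (v : n.+1.-tuple T) : T * n.-tuple T :=
  (thead v, [tuple of behead v]).

Lemma tconsK n : cancel (@tcons n) (@tuncons n).
Proof.
by move=> [x v]; rewrite /tuncons /tcons /= theadE; congr pair; exact: val_inj.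
Qed.

Lemma measurable_tuncons n : measurable_fun [set: n.+1.-tuple T] (@tuncons n).
Proof.
apply: measurable_fun_pair; first exact: measurable_tnth.
exact: measurable_behead.
Qed.

(** The induction must carry sigma-finiteness along with the measure axioms, since the product with
    the next line factor is a measure only over a sigma-finite [mu]. The canonical instances on
    [leb n] are then read off from this statement. *)
Lemma lebesgue_tuple_sigma_finite_measure n :
  exists mu : {sigma_finite_measure set (n.-tuple T) -> \bar R},
    mu = leb n :> (set _ -> _).
Proof.
elim: n => [|n [mu muE]]; first by exists (\d_([tuple] : 0.-tuple T)).
have [p' pE] : exists p : {measure set (n.+1.-tuple T) -> \bar R},
    p = pushforward (lebesgue_measure \x mu)%E (@tcons n) :> (set _ -> _).
  pose p : {measure set (n.+1.-tuple T) -> \bar R} :=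
    pushforward (lebesgue_measure \x mu)%E (@tcons n).
  by exists (p (@measurable_tcons n)).
have p0 : leb n.+1 set0 = 0%E by rewrite /= -muE -pE.
have pge0 A : (0 <= leb n.+1 A)%E by rewrite /= -muE -pE.
have padd : semi_sigma_additive (leb n.+1).
  by rewrite /= -muE -pE; exact: measure_semi_sigma_additive.
pose mp := isMeasure.Build _ _ _ (leb n.+1) p0 pge0 padd.
pose p := HB.pack_for {measure set (n.+1.-tuple T) -> \bar R} (leb n.+1) mp.
have sfp : sigma_finite setT p.
  have /sigma_finiteP[F [TF ndF Foo]] := sigma_finiteT (@lebesgue_measure R).
  have /sigma_finiteP[G [TG ndG Goo]] := sigma_finiteT mu.
  (* Exhaustions of both factors by sets of finite measure give rectangles of finite measure; since
     they are nondecreasing, the larger of two indices catches both components of a point. *)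
  exists (fun k => @tuncons n @^-1` (F k `*` G k)).
    rewrite -preimage_bigcup (_ : \bigcup_i _ = setT) ?preimage_setT//.
    rewrite -subTset => -[x v] _.
    have [i _ Fi] : (\bigcup_i F i) x by rewrite -TF.
    have [j _ Gj] : (\bigcup_i G i) v by rewrite -TG.
    exists (maxn i j) => //; split => /=.
    - by move: x Fi; exact/subsetPset/ndF/leq_maxl.
    - by move: v Gj; exact/subsetPset/ndG/leq_maxr.
  move=> k; have [? ?] := Foo k; have [? ?] := Goo k; split.
    rewrite -[_ @^-1` _]setTI; apply: measurable_tuncons => //.
    exact: measurableX.
  rewrite /= -muE /pushforward -comp_preimage.
  have -> : @tuncons n \o @tcons n = id by apply/funext => x; exact: tconsK.
  by rewrite preimage_id product_measure1E// lte_mul_pinfty// ge0_fin_numE.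
pose q := HB.pack_for {sigma_finite_measure set (n.+1.-tuple T) -> \bar R}
  (leb n.+1) mp (Measure_isSigmaFinite.Build _ _ _ p sfp).
by exists q.
Qed.

Let leb0 n : leb n set0 = 0%E.
Proof. by have [mu <-] := lebesgue_tuple_sigma_finite_measure n. Qed.

Let leb_ge0 n A : (0 <= leb n A)%E.
Proof. by have [mu <-] := lebesgue_tuple_sigma_finite_measure n. Qed.

Let leb_sigma_additive n : semi_sigma_additive (leb n).
Proof.
have [mu <-] := lebesgue_tuple_sigma_finite_measure n.
exact: measure_semi_sigma_additive.
Qed.

HB.instance Definition _ n :=
  isMeasure.Build _ _ _ (leb n) (@leb0 n) (@leb_ge0 n) (@leb_sigma_additive n).

Let leb_sigma_finite n : sigma_finite setT (leb n).
Proof.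
have [mu <-] := lebesgue_tuple_sigma_finite_measure n.
exact: sigma_finiteT.
Qed.

HB.instance Definition _ n :=
  Measure_isSigmaFinite.Build _ _ _ (leb n) (@leb_sigma_finite n).

Lemma lebesgue_tupleS n (A : set (n.+1.-tuple T)) :
  leb n.+1 A = (\int[@lebesgue_measure R]_x (leb n [set v | A (tcons (x, v))]))%E.
Proof.
by apply: eq_integral => x _ /=; congr (leb n _); apply/seteqP; split => v /=;
  rewrite /xsection /= inE.
Qed.

(** The other order of slicing, with the tail as outer variable: both iterated integrals define a
    measure with the product values on rectangles, and such a measure is unique. *)
Lemma lebesgue_tupleS2 n (A : set (n.+1.-tuple T)) : measurable A ->
  leb n.+1 A = (\int[leb n]_v (@lebesgue_measure R [set x | A (tcons (x, v))]))%E.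
Proof.
move=> mA.
have mA' : measurable (@tcons n @^-1` A).
  by rewrite -[_ @^-1` _]setTI; exact: measurable_tcons.
transitivity ((@lebesgue_measure R \x^ leb n)%E (@tcons n @^-1` A)).
  rewrite -(product_measure_unique (m1 := @lebesgue_measure R)
    (m2 := leb n) (m' := (@lebesgue_measure R \x^ leb n)%E)) //.
  by move=> ? ? ? ?; exact: product_measure2E.
by apply: eq_integral => x _ /=; congr (lebesgue_measure _);
  apply/seteqP; split => v /=; rewrite /ysection /= inE.
Qed.

End lebesgue_tuple_measure.

(** * Scaling of volume under invertible affine maps *)

Section affine_change_of_variables.
Variable R : realType.
Local Notation T := (measurableTypeR R).
Local Notation leb n := (@lebesgue_tuple R n).

(** The set function [|a|] times the measure of the preimage is a measure that agrees with Lebesgue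
    measure on half-open intervals, hence everywhere. *)
Lemma lebesgue_measure_affine (a b : R) (S : set T) : a != 0 -> measurable S ->
  lebesgue_measure [set x : T | S (a * x + b)] =
  (`|a|^-1%:E * lebesgue_measure S)%E.
Proof.
move=> a0 mS; pose f (x : T) : T := a * x + b.
have mf : measurable_fun setT f.
  by apply: measurable_funD => //; exact: measurable_funM.
pose m : {measure set T -> \bar R} := pushforward (@lebesgue_measure R) f.
have na : 0 <= `|a| by [].
have mE X : mscale (NngNum na) (m mf) X = (`|a|%:E * lebesgue_measure (f @^-1` X))%E.
  by [].
have -> : lebesgue_measure S = mscale (NngNum na) (m mf) S.
  apply: lebesgue_measure_unique mS => _ [[u w]] _ <-.
  transitivity (`|a|%:E * lebesgue_measure (f @^-1` `]u, w]%classic))%E; last by [].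
  have [ap|an] := ltP 0 a.
  - rewrite [X in (_ * lebesgue_measure X)%E](_ : _ =
      `](u - b) / a, (w - b) / a]%classic); last first.
      apply/seteqP; split => x /=; rewrite !in_itv/= ltr_pdivrMr // ler_pdivlMr //;
      by rewrite ltrBlDr lerBrDr mulrC.
    rewrite !lebesgue_measure_itv/= !lte_fin ltr_pM2r ?invr_gt0// ltrD2r.
    case: ifPn => uw; last by rewrite mule0.
    by rewrite -!EFinB -EFinM gtr0_norm//; congr EFin; field.
  (* A negative slope reverses the interval, so the preimage is closed on the left and open on the
     right; its length is unaffected. *)
  - have {}an : a < 0 by rewrite lt_neqAle a0.
    rewrite [X in (_ * lebesgue_measure X)%E](_ : _ =
      `[(w - b) / a, (u - b) / a[%classic); last first.
      apply/seteqP; split => x /=; rewrite !in_itv/= ltr_ndivlMr // ler_ndivrMr //;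
      by rewrite ltrBlDr lerBrDr mulrC andbC.
    rewrite !lebesgue_measure_itv/= !lte_fin ltr_nM2r ?invr_lt0// ltrD2r.
    case: ifPn => uw; last by rewrite mule0.
    by rewrite -!EFinB -EFinM ltr0_norm//; congr EFin; field.
by rewrite mE muleA -EFinM mulVf ?normr_eq0// mul1e.
Qed.

Definition vec_tuple n (x : 'cV[R]_n) : n.-tuple R := [tuple x i 0 | i < n].

Lemma tuple_vecK n : cancel (@tuple_vec R n) (@vec_tuple n).
Proof. by move=> v; apply: eq_from_tnth => i; rewrite tnth_mktuple mxE. Qed.

Lemma vec_tupleK n : cancel (@vec_tuple n) (@tuple_vec R n).
Proof. by move=> x; apply/colP => i; rewrite mxE tnth_mktuple. Qed.

(** The affine map [M x + b] transported to tuples, where the sigma-algebra and the measure live. *)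
Definition taff n (M : 'M[R]_n) (b : 'cV[R]_n) (v : n.-tuple T) : n.-tuple T :=
  vec_tuple (M *m tuple_vec v + b).

Lemma measurable_taff n (M : 'M[R]_n) b : measurable_fun setT (taff M b).
Proof.
apply/measurable_fun_tnthP => i.
rewrite (_ : _ \o _ = fun v : n.-tuple T => \sum_j M i j * tnth v j + b i 0).
  apply: measurable_funD => //; apply: measurable_sum => j.
  by apply: measurable_funM => //; exact: measurable_tnth.
apply/funext => v /=; rewrite tnth_mktuple !mxE; congr (_ + _).
by apply: eq_bigr => j _; rewrite mxE.
Qed.

Lemma measurable_taff_preimage n (M : 'M[R]_n) b (S : set (n.-tuple T)) :
  measurable S -> measurable (taff M b @^-1` S).
Proof. by move=> mS; rewrite -[_ @^-1` _]setTI; exact: measurable_taff. Qed.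

Lemma tuple_vec_tcons n (x : R) (v : n.-tuple T) :
  tuple_vec (tcons (x, v)) = col_mx x%:M (tuple_vec v) :> 'cV_(1 + n).
Proof.
apply/colP => i; rewrite mxE; case: (splitP i) => j ij.
  rewrite (_ : i = lshift n j) ?col_mxEu ?mxE; last exact: val_inj.
  by rewrite !ord1 mulr1n.
rewrite (_ : i = rshift 1 j) ?col_mxEd ?mxE; last exact: val_inj.
by rewrite (_ : rshift 1 j = lift ord0 j) ?tnthS //; exact: val_inj.
Qed.

Lemma vec_tuple_col_mx n (x : R) (v : 'cV[R]_n) :
  vec_tuple (col_mx x%:M v : 'cV_(1 + n)) = tcons (x, vec_tuple v).
Proof.
by rewrite -[v in LHS]vec_tupleK -tuple_vec_tcons tuple_vecK.
Qed.

Definition volume_scaling n (M : 'M[R]_n) := forall b (S : set (n.-tuple T)),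
  measurable S -> leb n (taff M b @^-1` S) = (`|\det M|^-1%:E * leb n S)%E.

Lemma taff_comp n (M1 M2 : 'M[R]_n) b :
  taff (M1 *m M2) b = taff M1 b \o taff M2 0.
Proof.
by apply/funext => v; rewrite /= /taff vec_tupleK addr0 mulmxA.
Qed.

Lemma volume_scaling_mul n (M1 M2 : 'M[R]_n) :
  volume_scaling M1 -> volume_scaling M2 -> volume_scaling (M1 *m M2).
Proof.
move=> s1 s2 b S mS; rewrite taff_comp comp_preimage s2; last first.
  exact: measurable_taff_preimage.
by rewrite s1// muleA -EFinM det_mulmx normrM invfM mulrC.
Qed.

(** The hypothesis on sets says that the image of [mu] under [phi] is [k] times [mu]; integrating
    against both sides gives the claim. *)
Lemma ge0_integral_scaling d (X : measurableType d)
    (mu : {measure set X -> \bar R}) (phi : X -> X) (k : R) (f : X -> \bar R) :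
  measurable_fun setT phi -> 0 <= k ->
  (forall S, measurable S -> mu (phi @^-1` S) = (k%:E * mu S)%E) ->
  measurable_fun setT f -> (forall v, 0 <= f v)%E ->
  (\int[mu]_v f (phi v) = k%:E * \int[mu]_v f v)%E.
Proof.
move=> mphi k0 sphi mf f0.
rewrite -(@ge0_integral_mscale _ _ R mu setT measurableT (NngNum k0))//.
have := @ge0_integral_pushforward _ _ _ _ R _ mphi mu setT f
  measurableT mf (fun x _ => f0 x).
rewrite preimage_setT => <-.
by apply: eq_measure_integral => A mA _; exact: sphi.
Qed.

Lemma ge0_integral_taff n (M : 'M[R]_n) b (f : n.-tuple T -> \bar R) :
  volume_scaling M -> measurable_fun setT f -> (forall v, 0 <= f v)%E ->
  (\int[leb n]_v f (taff M b v) = `|\det M|^-1%:E * \int[leb n]_v f v)%E.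
Proof.
move=> sM; apply: ge0_integral_scaling.
- exact: measurable_taff.
- by rewrite invr_ge0.
- by move=> S mS; exact: sM.
Qed.

Lemma taff_block n (M : 'M[R]_(1 + n)) (b : 'cV_(1 + n)) x v :
  taff M b (tcons (x, v)) = tcons
    (ulsubmx M 0 0 * x + (ursubmx M *m tuple_vec v + usubmx b) 0 0,
     taff (drsubmx M) (dlsubmx M *m x%:M + dsubmx b) v).
Proof.
rewrite /taff tuple_vec_tcons -{1}[M]submxK mul_block_col -{1}[b]vsubmxK.
rewrite add_col_mx.
set y := (X in col_mx X _).
rewrite -vec_tuple_col_mx (mx11_scalar y); congr (vec_tuple (col_mx _ _)).
  by congr (_%:M); rewrite /y [ulsubmx M]mx11_scalar -scalar_mxM !mxE !addrA mulr1n.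
by rewrite addrA [dlsubmx M *m _ + _]addrC.
Qed.

Lemma measurable_tcons1 n (v : n.-tuple T) :
  measurable_fun setT (fun x : T => tcons (x, v)).
Proof.
apply: (measurableT_comp (@measurable_tcons R n)).
by apply: measurable_fun_pair; [exact: measurable_id|exact: measurable_cst].
Qed.

Lemma measurable_tcons2 n (x : T) :
  measurable_fun setT (fun v : n.-tuple T => tcons (x, v)).
Proof.
apply: (measurableT_comp (@measurable_tcons R n)).
by apply: measurable_fun_pair; [exact: measurable_cst|exact: measurable_id].
Qed.

(** With the tail [v] frozen, the head moves by an affine map of slope [a], which contributes the
    inverse of [|a|]; the outer integral over [v] is then a change of variables by [M]. *)
Lemma volume_scaling_upper n (a : R) (r : 'rV[R]_n) (M : 'M[R]_n) :
  a != 0 -> volume_scaling M ->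
  volume_scaling (block_mx a%:M r 0 M : 'M[R]_(1 + n)).
Proof.
move=> a0 sM b S mS.
rewrite lebesgue_tupleS2; last exact: measurable_taff_preimage.
pose g (w : n.-tuple T) := lebesgue_measure [set x : T | S (tcons (x, w))].
have mg : measurable_fun setT g.
  rewrite (_ : g = lebesgue_measure \o ysection (@tcons R n @^-1` S)).
    apply: measurable_fun_ysection.
    by rewrite -[X in measurable X]setTI; exact: measurable_tcons.
  apply/funext => w; congr (lebesgue_measure _); apply/seteqP.
  by split => x; rewrite /ysection /= inE.
rewrite (eq_integral (fun v => `|a|^-1%:E * g (taff M (dsubmx b) v))%E); last first.
  move=> v _; rewrite -(@lebesgue_measure_affine _ ((r *m tuple_vec v + usubmx b) 0 0))//.
    congr (lebesgue_measure _); apply/funext => x.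
    rewrite /preimage /= taff_block block_mxKul block_mxKur block_mxKdl block_mxKdr.
    by rewrite mul0mx add0r !mxE eqxx mulr1n.
  by rewrite -[X in measurable X]setTI; exact: measurable_tcons1.
rewrite ge0_integralZl_EFin ?invr_ge0//; last first.
  by apply: measurableT_comp mg _; exact: measurable_taff.
rewrite ge0_integral_taff// lebesgue_tupleS2// muleA -EFinM.
by rewrite (@det_ublock _ 1 n) det_scalar1 normrM invfM.
Qed.

(** Here the head [x] is frozen: the tail moves by [M] with a translation depending on [x], and the
    outer integral is one-dimensional. *)
Lemma volume_scaling_lower n (a : R) (c : 'cV[R]_n) (M : 'M[R]_n) :
  a != 0 -> volume_scaling M ->
  volume_scaling (block_mx a%:M 0 c M : 'M[R]_(1 + n)).
Proof.
move=> a0 sM b S mS.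
rewrite lebesgue_tupleS.
pose g (y : T) := leb n [set w | S (tcons (y, w))].
have mg : measurable_fun setT g.
  rewrite (_ : g = leb n \o xsection (@tcons R n @^-1` S)).
    apply: measurable_fun_xsection.
    by rewrite -[X in measurable X]setTI; exact: measurable_tcons.
  apply/funext => w; congr (leb n _); apply/seteqP.
  by split => x; rewrite /xsection /= inE.
pose f (x : T) : T := a * x + usubmx b 0 0.
have mf : measurable_fun setT f.
  by apply: measurable_funD => //; exact: measurable_funM.
rewrite (eq_integral (fun x => `|\det M|^-1%:E * g (f x))%E); last first.
  move=> x _; rewrite -(@sM (c *m x%:M + dsubmx b)).
    congr (leb n _); apply/funext => v.
    rewrite /preimage /= taff_block block_mxKul block_mxKur block_mxKdl block_mxKdr.
    by rewrite mul0mx add0r [a%:M _ _]mxE eqxx mulr1n.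
  by rewrite -[X in measurable X]setTI; exact: measurable_tcons2.
rewrite ge0_integralZl_EFin ?invr_ge0//; last by apply: measurableT_comp mg _.
rewrite (@ge0_integral_scaling _ _ lebesgue_measure f (`|a|^-1))//.
  by rewrite lebesgue_tupleS muleA -EFinM (@det_lblock _ 1 n) det_scalar1 normrM invfM mulrC.
by move=> A mA; exact: lebesgue_measure_affine.
Qed.

(* M is a product of two block triangular matrices, for which Fubini's theorem
   reduces the change of variables to dimensions 1 and n. *)
Lemma volume_scaling_pivot n (M : 'M[R]_(1 + n)) :
  (forall N : 'M[R]_n, N \in unitmx -> volume_scaling N) ->
  M \in unitmx -> ulsubmx M 0 0 != 0 -> volume_scaling M.
Proof.
move=> IH uM; set a := ulsubmx M 0 0 => a0.
(* [D] is the Schur complement of the pivot. *)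
pose D := drsubmx M - a^-1 *: (dlsubmx M *m ursubmx M).
have ME : M = block_mx 1%:M 0 (a^-1 *: dlsubmx M) 1%:M *m
    block_mx a%:M (ursubmx M) 0 D.
  rewrite mulmx_block !mul1mx !mul0mx !addr0 -scalemxAl mul_mx_scalar.
  rewrite scalerA mulVf// scale1r -scalemxAl addrC subrK.
  by rewrite -mx11_scalar submxK.
have uD : D \in unitmx.
  move: uM; rewrite ME !unitmxE det_mulmx (@det_ublock _ 1 n) unitrM => /andP[_].
  by rewrite unitrM => /andP[].
rewrite ME; apply: volume_scaling_mul.
- by apply: volume_scaling_lower; [rewrite oner_eq0|apply: IH; rewrite unitmx1].
- by apply: volume_scaling_upper => //; exact: IH.
Qed.

(** Induction on the dimension by Gaussian elimination: a zero pivot is first repaired by a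
    transvection. *)
Lemma volume_scaling_unitmx n (M : 'M[R]_n) : M \in unitmx -> volume_scaling M.
Proof.
elim: n M => [|n IH] M uM.
  move=> b S mS; rewrite det_mx00 normr1 invr1 mul1e; congr (leb 0 _).
  by apply/funext => v; congr (S _); rewrite [LHS]tuple0 [RHS]tuple0.
have [M00|M00] := eqVneq (ulsubmx (M : 'M[R]_(1 + n)) 0 0) 0; last first.
  exact: volume_scaling_pivot.
(* The first column of an invertible matrix is nonzero; as its top entry vanishes, a nonzero one
   lies below. *)
have [j Mj] : exists j, dlsubmx (M : 'M[R]_(1 + n)) j 0 != 0.
  apply/existsP; apply: contraT; rewrite negb_exists => /forallP M0.
  have : col 0 M = 0.
    apply/colP => i; rewrite !mxE.
    have [<-|/unlift_some[k ik _]] := eqVneq 0 i.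
      by move: M00; rewrite !mxE => <-; congr (M _ _); exact: val_inj.
    have := M0 k; rewrite negbK !mxE => /eqP <-.
    by congr (M _ _); [rewrite ik|]; exact: val_inj.
  rewrite colE => /(congr1 (mulmx (invmx M))); rewrite mulKmx// mulmx0.
  by move/matrixP/(_ 0 0)/eqP; rewrite !mxE eqxx oner_eq0.
(* Multiplication by U e adds row j of the lower block to the first row, which
   makes the pivot nonzero. *)
pose e : 'rV[R]_n := delta_mx 0 j.
pose U (e : 'rV[R]_n) : 'M[R]_(1 + n) := block_mx 1%:M e 0 1%:M.
have UU : U (- e) *m U e = 1%:M.
  rewrite mulmx_block !mul1mx !mul0mx !mulmx0 mulmx1 !addr0 subrr add0r.
  exact: esym (@scalar_mx_block _ 1 n 1).
have sU e' : volume_scaling (U e').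
  by apply: volume_scaling_upper; [rewrite oner_eq0|apply: IH; rewrite unitmx1].
rewrite -[M]mul1mx -UU -mulmxA; apply: volume_scaling_mul; first exact: sU.
have [_ uU] := mulmx1_unit UU.
apply: volume_scaling_pivot => //; first by rewrite unitmx_mul uU.
rewrite -[X in _ *m X](@submxK _ 1 n 1 n) [_ *m _](@mulmx_block _ 1 n 1 n 1 n).
rewrite block_mxKul mul1mx mxE M00 add0r.
by rewrite /e -rowE mxE.
Qed.

End affine_change_of_variables.

(** * Volume of ellipsoids and integral of exponential cones *)

Section ball_and_cone.
Variable R : realType.
Local Notation T := (measurableTypeR R).
Local Notation leb n := (@lebesgue_tuple R n).
Local Notation enorm := (@euclidean_norm R _).

Lemma euclidean_norm_ge0 n (x : 'cV[R]_n) : 0 <= enorm x.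
Proof. exact: sqrtr_ge0. Qed.

Lemma sqr_euclidean_norm n (x : 'cV[R]_n) : enorm x ^+ 2 = \sum_i x i 0 ^+ 2.
Proof. by rewrite sqr_sqrtr// sumr_ge0// => i _; rewrite sqr_ge0. Qed.

Lemma ler_coord_euclidean_norm n (x : 'cV[R]_n) i : `|x i 0| <= enorm x.
Proof.
rewrite -(ler_pXn2r (n := 2)) ?nnegrE ?euclidean_norm_ge0//.
rewrite real_normK ?num_real// sqr_euclidean_norm (bigD1 i)//= lerDl.
by rewrite sumr_ge0// => j _; rewrite sqr_ge0.
Qed.

Lemma measurable_euclidean_norm n :
  measurable_fun setT (fun v : n.-tuple T => enorm (tuple_vec v)).
Proof.
apply: (measurableT_comp (f := @Num.sqrt R)).
  by apply: continuous_measurable_fun; exact: sqrt_continuous.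
apply: measurable_sum => i; apply: measurable_funX.
rewrite (_ : (fun _ => _) = @tnth n T ^~ i); first exact: measurable_tnth.
by apply/funext => v; rewrite mxE.
Qed.

Definition tball n : set (n.-tuple T) := [set v | enorm (tuple_vec v) <= 1].

Lemma measurable_tball n : measurable (@tball n).
Proof.
rewrite (_ : @tball n = setT `&` (fun v => enorm (tuple_vec v)) @^-1` `]-oo, 1]).
  by apply: measurable_euclidean_norm.
by rewrite setTI; apply/seteqP; split => v /=; rewrite in_itv.
Qed.

Definition tcube n (r : R) : set (n.-tuple T) := [set v | forall i, `|tnth v i| <= r].

Lemma tcubeS n (r : R) : @tcons R n @^-1` tcube r = `[- r, r]%classic `*` tcube r.
Proof.
apply/seteqP; split => [[x v] h|[x v] [/= h1 h2] i] /=.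
  split => [|i]; first by have := h ord0; rewrite /= tnth0 in_itv/= ler_norml.
  by have := h (lift ord0 i); rewrite tnthS.
have [<-|/unlift_some[j ij _]] := eqVneq ord0 i.
  by rewrite tnth0 /=; move: h1; rewrite in_itv/= -ler_norml.
by rewrite ij tnthS; exact: h2.
Qed.

Lemma measurable_tcube n r : measurable (@tcube n r).
Proof.
rewrite (_ : tcube _ = \bigcap_(i in [set: 'I_n])
   (setT `&` (@tnth n T ^~ i) @^-1` `[- r, r])).
  apply: fin_bigcap_measurable; first exact: finite_finset.
  by move=> i _; apply: measurable_tnth.
apply/seteqP; split => v /= h i => [_|]; first by rewrite /= in_itv/= -ler_norml.
by have [_] := h i Logic.I; rewrite /= in_itv/= -ler_norml.
Qed.

Lemma lebesgue_tuple_tcube n (r : R) : 0 < r -> leb n (tcube r) = ((2 * r) ^+ n)%:E.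
Proof.
move=> r0; elim: n => [|n IH].
  by rewrite /= diracE mem_set//= => -[].
rewrite [LHS](_ : _ = (lebesgue_measure \x leb n)%E (@tcons R n @^-1` tcube r))//.
rewrite tcubeS product_measure1E//; last exact: measurable_tcube.
rewrite [X in (_ * X)%E]IH exprS EFinM; congr (_ * _)%E.
have -> : 2 * r = r - - r by ring.
apply: etrans (lebesgue_measure_itv `[- r, r]) _.
by rewrite /= lte_fin ifT//; lra.
Qed.

(** The ball lies between two cubes, whose volumes are explicit, positive and finite. *)
Lemma lebesgue_tuple_tball n : exists2 v : R, 0 < v & leb n (@tball n) = v%:E.
Proof.
(* In the cube of half-side [r] the squared norm is at most [n r^2 <= n r <= 1]; [n.+1] keeps [r]
   positive in dimension 0. *)
pose r : R := n.+1%:R^-1.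
have r0 : 0 < r by rewrite invr_gt0.
have h1 : (leb n (tcube r) <= leb n (@tball n))%E.
  apply: le_measure; rewrite ?inE; [exact: measurable_tcube|exact: measurable_tball|].
  move=> v /= vr; rewrite /tball /= -(ler_pXn2r (n := 2)) ?nnegrE ?euclidean_norm_ge0//.
  rewrite sqr_euclidean_norm.
  apply: (@le_trans _ _ (\sum_(i < n) r)).
    apply: ler_sum => i _; rewrite mxE -real_normK ?num_real//.
    apply: (@le_trans _ _ (r ^+ 2)); first by rewrite lerXn2r ?nnegrE ?(ltW r0) ?vr.
    by rewrite expr2 ger_pMl// invf_le1// ler1n.
  rewrite sumr_const card_ord -mulr_natl /r expr1n ler_pdivrMr// mul1r ler_nat.
  exact: leqnSn.
have h2 : (leb n (@tball n) <= leb n (tcube 1))%E.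
  apply: le_measure; rewrite ?inE; [exact: measurable_tball|exact: measurable_tcube|].
  move=> v /= v1 i; apply: le_trans v1.
  by have := ler_coord_euclidean_norm (tuple_vec v) i; rewrite mxE.
rewrite !lebesgue_tuple_tcube// in h1 h2.
have fin : leb n (@tball n) \is a fin_num.
  by rewrite ge0_fin_numE//; apply: le_lt_trans h2 (ltry _).
exists (fine (leb n (@tball n))); last by rewrite fineK.
rewrite -lte_fin fineK//; apply: lt_le_trans h1.
by rewrite lte_fin exprn_gt0// mulr_gt0.
Qed.


(** The integrand is at most [r^-1] times the sum of the exponential density of rate [r] and its
    reflection, each of total mass 1. *)
Lemma integral_expN_abs (r : R) : 0 < r ->
  (\int[@lebesgue_measure R]_x (expR (- (r * `|x|)))%:E < +oo)%E.
Proof.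
move=> r0.
have mpdf := measurable_exponential_pdf r.
have mpdfN : measurable_fun setT (fun x : T => exponential_pdf r (- x)).
  by apply: (measurableT_comp mpdf).
have pdf0 x := exponential_pdf_ge0 (ltW r0) x.
have iN : (\int[@lebesgue_measure R]_x (exponential_pdf r (- x))%:E = 1)%E.
  rewrite (@ge0_integral_scaling _ _ _ lebesgue_measure (-%R : T -> T) 1
    (EFin \o exponential_pdf r))//.
  - by rewrite mul1e integral_exponential_pdf.
  - by move=> S mS; rewrite mul1e; exact: lebesgue_measureN.
  - exact/measurable_EFinP.
apply: (@le_lt_trans _ _ (\int[@lebesgue_measure R]_x (r^-1%:E *
   ((exponential_pdf r x)%:E + (exponential_pdf r (- x))%:E)))%E).
  apply: ge0_le_integral => //.
  - apply/measurable_EFinP; apply: (measurableT_comp (@measurable_expR R)).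
    apply: (measurableT_comp (@oppr_measurable R setT)).
    by apply: measurable_funM => //; exact: normr_measurable.
  - apply: measurable_funeM; apply: emeasurable_funD; exact/measurable_EFinP.
  - move=> x _; rewrite -EFinD -EFinM lee_fin.
    have [x0|x0] := leP 0 x.
      rewrite exponential_pdfE// ger0_norm// mulrDr mulKf ?gt_eqF// mulNr lerDl.
      by rewrite mulr_ge0// invr_ge0 ltW.
    rewrite [exponential_pdf r (- x)]exponential_pdfE ?oppr_ge0 ?(ltW x0)//.
    rewrite ltr0_norm// mulrDr mulKf ?gt_eqF// mulNr lerDr.
    by rewrite mulr_ge0// invr_ge0 ltW.
rewrite ge0_integralZl_EFin//; last 3 first.
- by move=> x _; rewrite adde_ge0// lee_fin.
- by apply: emeasurable_funD; exact/measurable_EFinP.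
- by rewrite invr_ge0 ltW.
rewrite ge0_integralD//; last 4 first.
- by move=> x _; rewrite lee_fin.
- exact/measurable_EFinP.
- by move=> x _; rewrite lee_fin.
- exact/measurable_EFinP.
by rewrite iN integral_exponential_pdf// -EFinD -EFinM ltry.
Qed.

(** By Tonelli, each coordinate splits off one finite one-dimensional factor. *)
Lemma integral_prod_tnth n (k : R -> R) :
  measurable_fun setT k -> (forall x, 0 <= k x) ->
  (\int[@lebesgue_measure R]_x (k x)%:E < +oo)%E ->
  (\int[leb n]_v (\prod_i k (tnth v i))%:E < +oo)%E.
Proof.
move=> mk k0 kfin.
have mP m : measurable_fun setT (fun v : m.-tuple T => (\prod_i k (tnth v i))%:E).
  apply/measurable_EFinP; apply: measurable_prod => i _.
  by apply: (measurableT_comp mk); exact: measurable_tnth.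
have P0 m (v : m.-tuple T) : (0 <= (\prod_i k (tnth v i))%:E)%E.
  by rewrite lee_fin prodr_ge0.
elim: n => [|n IH].
  rewrite [ltLHS]integral_dirac//; last exact: mP.
  by rewrite ?diracE ?in_setT ?mul1e ltry.
have := @ge0_integral_pushforward _ _ _ _ R _ (@measurable_tcons R n)
  (lebesgue_measure \x leb n)%E setT _ measurableT (mP n.+1) (fun x _ => P0 _ x).
rewrite preimage_setT => E.
rewrite [ltLHS](_ : _ = \int[(lebesgue_measure \x leb n)%E]_x
  ((k x.1)%:E * (\prod_i k (tnth x.2 i))%:E))%E; last first.
  apply: etrans E _; apply: eq_integral => -[x v] _ /=.
  rewrite big_ord_recl tnth0 EFinM; congr (_ * (_)%:E)%E.
  by apply: eq_bigr => i _; rewrite tnthS.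
rewrite fubini_tonelli1//; last 2 first.
- apply: emeasurable_funM.
    by apply/measurable_EFinP; apply: (measurableT_comp mk).
  exact: (measurableT_comp (mP n)).
- by move=> x; rewrite mule_ge0// lee_fin.
rewrite (eq_integral (fun x : T => (k x)%:E * \int[leb n]_v (\prod_i k (tnth v i))%:E)%E);
  last first.
  move=> x _; rewrite /fubini_F -ge0_integralZl_EFin//; exact: mP.
rewrite ge0_integralZr//; last 3 first.
- exact/measurable_EFinP.
- by move=> x _; rewrite lee_fin.
- by apply: integral_ge0 => v _.
apply: lte_mul_pinfty => //.
  by apply: integral_ge0 => v _; rewrite lee_fin.
by rewrite ge0_fin_numE//; apply: integral_ge0 => v _; rewrite lee_fin.
Qed.

Lemma measurable_expN_euclidean_norm n :
  measurable_fun setT (fun v : n.-tuple T => (expR (- enorm (tuple_vec v)))%:E).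
Proof.
apply/measurable_EFinP; apply: (measurableT_comp (@measurable_expR R)).
apply: (measurableT_comp (@oppr_measurable R setT)).
exact: measurable_euclidean_norm.
Qed.

Lemma integral_expN_euclidean_norm n : exists2 c : R, 0 < c &
  (\int[leb n]_v (expR (- enorm (tuple_vec v)))%:E = c%:E)%E.
Proof.
have mexp := @measurable_expN_euclidean_norm n.
set I := integral _ _ _.
(* On the unit ball, which has positive volume, the integrand is at least [expR (-1)]. *)
have I0 : (0 < I)%E.
  have [v v0 vE] := lebesgue_tuple_tball n.
  apply: (@lt_le_trans _ _ ((expR (-1))%:E * v%:E)%E).
    by rewrite mule_gt0// lte_fin expR_gt0.
  rewrite -vE -[X in leb n X]setIT -integral_indic//; last exact: measurable_tball.
  rewrite -ge0_integralZl_EFin ?expR_ge0//; last 1 first.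
  - by apply/measurable_EFinP; apply: measurable_indic; exact: measurable_tball.
  apply: ge0_le_integral => //.
  - apply: measurable_funeM; apply/measurable_EFinP; apply: measurable_indic.
    exact: measurable_tball.
  - move=> x _; rewrite -EFinM lee_fin indicE.
    have [|] := boolP (x \in _); last by rewrite mulr0 expR_ge0.
    by rewrite inE /tball /= mulr1 ler_expR lerN2.
have Ifin : (I < +oo)%E.
  (* Each coordinate is bounded by the norm, so [r] times the sum of the [|x_i|] is at most the
     norm, and the integrand is dominated by a product of one-dimensional exponentials. *)
  pose r : R := n.+1%:R^-1.
  have r0 : 0 < r by rewrite invr_gt0.
  apply: le_lt_trans (@integral_prod_tnth n (fun x => expR (- (r * `|x|))) _ _ _).
  - apply: ge0_le_integral => //.
    + apply/measurable_EFinP; apply: measurable_prod => i _.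
      apply: (measurableT_comp (@measurable_expR R)).
      apply: (measurableT_comp (@oppr_measurable R setT)).
      apply: measurable_funM => //; apply: measurableT_comp (@measurable_tnth _ _ _ _).
      exact: normr_measurable.
    + move=> x _; rewrite lee_fin -expR_sum ler_expR sumrN lerN2 -mulr_sumr.
      rewrite /r mulrC ler_pdivrMr//.
      apply: (@le_trans _ _ (\sum_(i < n) enorm (tuple_vec x))).
        apply: ler_sum => i _.
        by have := ler_coord_euclidean_norm (tuple_vec x) i; rewrite mxE.
      rewrite sumr_const card_ord -[_ *+ n]mulr_natr; apply: ler_wpM2l.
        exact: euclidean_norm_ge0.
      by rewrite ler_nat.
  - apply: (measurableT_comp (@measurable_expR R)).
    apply: (measurableT_comp (@oppr_measurable R setT)).
    by apply: measurable_funM => //; exact: normr_measurable.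
  - by move=> x; exact: expR_ge0.
  - exact: integral_expN_abs.
have fin : I \is a fin_num by rewrite ge0_fin_numE// ltW.
by exists (fine I); [rewrite -lte_fin fineK|rewrite fineK].
Qed.

(** The ellipsoid is the preimage of the ball, so the determinant divides. The constant [v] depends
    on [n] only, which reduces comparing volumes to comparing determinants. *)
Lemma volume_affine_ball n : exists2 v : R, 0 < v &
  forall (M : 'M[R]_n) b, M \in unitmx ->
    volume [set x | enorm (M *m x + b) <= 1] = (v / `|\det M|)%:E.
Proof.
have [v v0 vE] := lebesgue_tuple_tball n; exists v => // M b uM.
rewrite mulrC EFinM -vE -(volume_scaling_unitmx uM b); last exact: measurable_tball.
by congr (leb n _); apply/funext => x; rewrite /tball /preimage /= vec_tupleK.
Qed.

Lemma integral_exp_cone n : exists2 c : R, 0 < c &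
  forall (M : 'M[R]_n) b t, M \in unitmx ->
    integral_Rn (exp_cone (fun x => M *m x + b) t) = (c * expR t / `|\det M|)%:E.
Proof.
have [c c0 cE] := integral_expN_euclidean_norm n; exists c => // M b t uM.
rewrite /integral_Rn /exp_cone.
under eq_integral do rewrite expRD mulrC EFinM -[M *m _ + b]vec_tupleK.
rewrite ge0_integralZl_EFin ?expR_ge0//; last first.
  apply: (measurableT_comp (@measurable_expN_euclidean_norm n)).
  exact: measurable_taff.
rewrite (ge0_integral_taff b (volume_scaling_unitmx uM)
  (@measurable_expN_euclidean_norm n)).
  by rewrite cE -!EFinM; congr EFin; ring.
by move=> v; rewrite lee_fin expR_ge0.
Qed.

End ball_and_cone.

(** * Affine maps of maximal determinant into the ball: uniqueness *)

Section extremal_affine_maps.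
Variable R : realType.
Local Notation enorm := (@euclidean_norm R _).

(** The radicand of [euclidean_norm]: being polynomial, it suits algebraic identities and
    continuity. *)
Definition sqnorm n (x : 'cV[R]_n) : R := \sum_i x i 0 ^+ 2.

Lemma sqnormE n (x : 'cV[R]_n) : (sqnorm x)%:M = x^T *m x.
Proof.
rewrite [RHS]mx11_scalar; congr (_%:M); rewrite mxE.
by apply: eq_bigr => i _; rewrite mxE expr2.
Qed.

Lemma sqnorm_ge0 n (x : 'cV[R]_n) : 0 <= sqnorm x.
Proof. by rewrite sumr_ge0// => i _; rewrite sqr_ge0. Qed.

Lemma sqnorm_eq0 n (x : 'cV[R]_n) : (sqnorm x == 0) = (x == 0).
Proof.
rewrite psumr_eq0; last by move=> i _; rewrite sqr_ge0.
apply/allP/eqP => [h|-> i _]; last by rewrite mxE expr0n /= eqxx.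
apply/colP => i; rewrite mxE; apply/eqP.
by have := h i (mem_index_enum i); rewrite sqrf_eq0.
Qed.

Lemma sqnormZ n (a : R) (x : 'cV[R]_n) : sqnorm (a *: x) = a ^+ 2 * sqnorm x.
Proof. by rewrite /sqnorm mulr_sumr; apply: eq_bigr => i _; rewrite mxE exprMn. Qed.

(** The parallelogram law; the subtracted term measures the strict convexity of the ball. *)
Lemma sqnorm_midpoint n (x y : 'cV[R]_n) :
  sqnorm (2^-1 *: (x + y)) = 2^-1 * (sqnorm x + sqnorm y) - 4^-1 * sqnorm (x - y).
Proof.
rewrite /sqnorm -big_split /= !mulr_sumr -sumrB.
by apply: eq_bigr => i _; rewrite !mxE; field.
Qed.

Lemma sqnorm_orthogonal n (Q : 'M[R]_n) x :
  Q^T *m Q = 1%:M -> sqnorm (Q *m x) = sqnorm x.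
Proof.
move=> QQ; have : (sqnorm (Q *m x))%:M = (sqnorm x)%:M :> 'M[R]_1.
  by rewrite !sqnormE trmx_mul -mulmxA [_ *m (Q *m x)]mulmxA QQ mul1mx.
by move/matrixP/(_ 0 0); rewrite !mxE.
Qed.

Lemma normr_det_orthogonal n (Q : 'M[R]_n) : Q^T *m Q = 1%:M -> `|\det Q| = 1.
Proof.
move/(congr1 determinant); rewrite det_mulmx det_tr det1 -expr2 => Q1.
by apply/eqP; rewrite -(sqrp_eq1 (normr_ge0 _)) real_normK ?num_real// Q1.
Qed.

(** [H] is the reflection in the hyperplane orthogonal to [w = x - a e_0], which exchanges the
    vectors [x] and [a e_0] of equal length; if [w = 0] the identity serves. *)
Lemma householder n (x : 'cV[R]_n.+1) : exists2 H : 'M[R]_n.+1,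
  H^T *m H = 1%:M & H *m x = Num.sqrt (sqnorm x) *: delta_mx 0 0.
Proof.
pose a := Num.sqrt (sqnorm x); pose w := x - a *: delta_mx 0 0.
have [w0|w0] := eqVneq w 0.
  exists 1%:M; first by rewrite trmx1 mulmx1.
  by rewrite mul1mx; apply/eqP; rewrite -subr_eq0 -/a -/w w0.
have s0 : sqnorm w != 0 by rewrite sqnorm_eq0.
pose H := 1%:M - (2 / sqnorm w) *: (w *m w^T).
have HT : H^T = H.
  by rewrite /H linearB /= trmx1 linearZ /= trmx_mul trmxK.
have ww : w *m w^T *m (w *m w^T) = sqnorm w *: (w *m w^T).
  by rewrite mulmxA -[w *m _ *m w]mulmxA -sqnormE mul_mx_scalar -scalemxAl.
have xe : x^T *m delta_mx 0 0 = (x 0 0)%:M :> 'M[R]_1.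
  by rewrite -colE [LHS]mx11_scalar !mxE.
have ex : (delta_mx 0 0)^T *m x = (x 0 0)%:M :> 'M[R]_1.
  by rewrite trmx_delta -rowE [LHS]mx11_scalar mxE.
have ee : (delta_mx 0 0 : 'cV[R]_n.+1)^T *m delta_mx 0 0 = 1%:M :> 'M[R]_1.
  by rewrite trmx_delta mul_delta_mx [LHS]mx11_scalar mxE.
(* The vector [x + x - w] is [x + a e_0], and the sum and the difference of two vectors of equal
   length are orthogonal. *)
have wxw : w^T *m (x + x - w) = 0.
  have -> : x + x - w = x + a *: delta_mx 0 0.
    by rewrite /w opprB [_ - x]addrC addrA addrK.
  rewrite /w linearB /= linearZ /= mulmxBl !mulmxDr -!scalemxAl -!scalemxAr.
  rewrite xe ex ee -sqnormE.
  rewrite scalerA -expr2 sqr_sqrtr ?sqnorm_ge0// !scale_scalar_mx mulr1.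
  by rewrite [X in _ - X]addrC subrr.
have wx : w^T *m x = (sqnorm w / 2)%:M.
  move/eqP: wxw; rewrite mulmxBr subr_eq0 -sqnormE mulmxDr => /eqP.
  rewrite [w^T *m x]mx11_scalar -raddfD => /matrixP/(_ 0 0).
  rewrite !mxE eqxx !mulr1n => <-.
  by congr (_%:M); field.
exists H.
  rewrite HT /H mulmxBl mul1mx mulmxBr mulmx1 -scalemxAl -scalemxAr ww !scalerA !mulrA.
  have -> : 2 / sqnorm w * 2 / sqnorm w * sqnorm w = 2 / sqnorm w + 2 / sqnorm w.
    by field.
  by rewrite scalerDl opprB addrK subrK.
rewrite /H mulmxBl mul1mx -scalemxAl -mulmxA wx mul_mx_scalar scalerA.
have -> : 2 / sqnorm w * (sqnorm w / 2) = 1 by field.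
by rewrite scale1r /w subKr.
Qed.

(* A reflection H sends N e_0 to a e_0, which makes H N block triangular with
   pivot a; then 1 + Q N is block triangular with pivot 1 + a, and
   (1 + a)^2 >= 4 a with equality only for a = 1. *)
Lemma rotation_step n (N : 'M[R]_n.+1) :
  (forall N' : 'M[R]_n, exists2 Q : 'M[R]_n, Q^T *m Q = 1%:M &
    4 ^+ n * `|\det N'| <= \det (1%:M + Q *m N') ^+ 2) ->
  let a := Num.sqrt (sqnorm (N *m delta_mx 0 0)) in
  exists Q d, [/\ Q^T *m Q = 1%:M, 0 <= d, `|\det N| = a * d &
    4 ^+ n * ((1 + a) ^+ 2 * d) <= \det (1%:M + Q *m N) ^+ 2].
Proof.
move=> IH a; have [H HH Ha] := householder (N *m delta_mx 0 0); rewrite -/a in Ha.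
pose HN : 'M[R]_(1 + n) := H *m N.
have ul : ulsubmx HN = a%:M.
  apply/matrixP => i j; rewrite !ord1 !mxE eqxx mulr1n.
  have := Ha; rewrite mulmxA -colE => /matrixP/(_ 0 0); rewrite !mxE eqxx mulr1 => <-.
  by apply: eq_bigr => k _; congr (H _ _ * N _ _); exact: val_inj.
have dl : dlsubmx HN = 0.
  apply/matrixP => i j; rewrite !ord1 !mxE.
  have := Ha; rewrite mulmxA -colE => /matrixP/(_ (rshift 1 i) 0).
  rewrite !mxE /= mulr0 => E; rewrite -[RHS]E.
  by apply: eq_bigr => k _; congr (H _ _ * N _ _); exact: val_inj.
have HNE : HN = block_mx a%:M (ursubmx HN) 0 (drsubmx HN).
  by rewrite -ul -dl submxK.
have [Q' QQ' hQ'] := IH (drsubmx HN).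
(* [B] applies the rotation of the lower block and fixes the first coordinate, so [B H N] keeps its
   triangular form and its pivot. *)
pose B : 'M[R]_(1 + n) := block_mx 1%:M 0 0 Q'.
have BB : B^T *m B = 1%:M.
  rewrite tr_block_mx !trmx0 trmx1 mulmx_block !mulmx0 !mul0mx !mul1mx QQ' !addr0 add0r.
  by rewrite -scalar_mx_block.
exists (B *m H), `|\det (drsubmx HN)|; split=> //.
- by rewrite trmx_mul -mulmxA [B^T *m _]mulmxA BB mul1mx.
- rewrite -[LHS]mul1r -(normr_det_orthogonal HH) -normrM -det_mulmx -/HN HNE.
  rewrite (@det_ublock _ 1 n) det_scalar1 normrM block_mxKdr.
  by rewrite ger0_norm ?sqrtr_ge0.
- rewrite -mulmxA -/HN.
  have -> : 1%:M + B *m HN = block_mx (1 + a)%:M (ursubmx HN) 0 (1%:M + Q' *m drsubmx HN).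
    rewrite {1}HNE mulmx_block !mulmx0 !mul0mx !mul1mx !addr0 !add0r.
    by rewrite (@scalar_mx_block _ 1 n) add_block_mx !add0r raddfD.
  rewrite (@det_ublock _ 1 n) det_scalar1 exprMn mulrCA.
  by rewrite ler_wpM2l ?sqr_ge0.
Qed.

(** After division by [4 ^+ n] this bounds the determinant of the half sum of [1] and [Q N] from
    below. The inequality [4 a <= (1 + a)^2] is applied to one pivot per dimension. *)
Lemma exists_rotation_det n (N : 'M[R]_n) : exists2 Q : 'M[R]_n, Q^T *m Q = 1%:M &
  4 ^+ n * `|\det N| <= \det (1%:M + Q *m N) ^+ 2.
Proof.
elim: n N => [|n IH] N.
  by exists 1%:M; rewrite ?trmx1 ?mulmx1// !det_mx00 normr1 expr0 expr1n mulr1.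
have [Q [d [QQ d0 -> h]]] := rotation_step N IH.
exists Q => //; apply: le_trans h.
set a := Num.sqrt _.
rewrite exprSr -mulrA ler_wpM2l ?exprn_ge0// mulrA ler_wpM2r//.
by have := sqr_ge0 (1 - a); rewrite -subr_ge0; congr (0 <= _); ring.
Qed.

(* In an orthonormal basis starting along x, the first pivot is |N x| / |x|,
   which differs from 1. *)
Lemma exists_rotation_det_strict n (N : 'M[R]_n) x : N \in unitmx ->
  sqnorm (N *m x) != sqnorm x ->
  exists2 Q : 'M[R]_n, Q^T *m Q = 1%:M &
    4 ^+ n * `|\det N| < \det (1%:M + Q *m N) ^+ 2.
Proof.
case: n N x => [|n] N x uN Nx; first by move: Nx; rewrite /sqnorm !big_ord0 eqxx.
have [H HH Hx] := householder x.
have HHT : H *m H^T = 1%:M by exact: mulmx1C.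
have [Q [d [QQ d0 dN h]]] :=
  rotation_step (H *m N *m H^T) (@exists_rotation_det n).
have x0 : 0 < sqnorm x.
  rewrite lt0r sqnorm_ge0 andbT sqnorm_eq0; apply/eqP => x0.
  by move: Nx; rewrite x0 mulmx0 eqxx.
set b := Num.sqrt (sqnorm x) in Hx.
have b0 : 0 < b by rewrite sqrtr_gt0.
move: dN h; set a := Num.sqrt _ => dN h.
have aE : b ^+ 2 * a ^+ 2 = sqnorm (N *m x).
  rewrite [a ^+ 2]sqr_sqrtr ?sqnorm_ge0// -sqnormZ scalemxAr -Hx mulmxA.
  by rewrite -[_ *m _ *m H]mulmxA HH mulmx1 -mulmxA (sqnorm_orthogonal _ HH).
have detE : `|\det N| = a * d.
  rewrite -dN !det_mulmx !normrM det_tr (normr_det_orthogonal HH).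
  by rewrite mul1r mulr1.
(* Invertibility of [N] makes [d] nonzero, so the strict inequality at the first pivot survives
   multiplication by [d]. *)
have {}d0 : 0 < d.
  rewrite lt0r d0 andbT; apply/eqP => d00; move: uN.
  by rewrite unitmxE unitfE -normr_eq0 detE d00 mulr0 eqxx.
have a1 : a != 1.
  apply: contra Nx => /eqP a1; rewrite -aE a1 expr1n mulr1.
  by rewrite /b sqr_sqrtr ?sqnorm_ge0.
(* The rotation found in the adapted basis is conjugated back to the original one. *)
exists (H^T *m Q *m H).
  rewrite !trmx_mul trmxK !mulmxA -[_ *m H *m H^T]mulmxA HHT mulmx1.
  by rewrite -[_ *m Q^T *m Q]mulmxA QQ mulmx1.
have -> : 1%:M + H^T *m Q *m H *m N = H^T *m (1%:M + Q *m (H *m N *m H^T)) *m H.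
  rewrite mulmxDr mulmxDl mulmx1 HH; congr (_ + _).
  by rewrite !mulmxA -[RHS]mulmxA HH mulmx1.
rewrite !det_mulmx det_tr mulrAC -expr2 exprMn -[\det H ^+ 2]real_normK ?num_real//.
rewrite (normr_det_orthogonal HH) !expr1n mul1r detE.
apply: lt_le_trans h; rewrite exprSr -mulrA ltr_pM2l ?exprn_gt0// mulrA ltr_pM2r//.
have -> : (1 + a) ^+ 2 = 4 * a + (1 - a) ^+ 2 by ring.
by rewrite ltrDl lt0r sqr_ge0 andbT sqrf_eq0 subr_eq0 eq_sym.
Qed.

Lemma euclidean_norm_le1 n (x : 'cV[R]_n) : (enorm x <= 1) = (sqnorm x <= 1).
Proof. by rewrite -[X in _ <= X](@sqrtr1 R) ler_sqrt. Qed.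

(** A closed condition on the pair [(M, b)]; invertibility is imposed separately. *)
Definition maps_into_ball n (K : set 'cV[R]_n) (M : 'M[R]_n) (b : 'cV[R]_n) :=
  forall x, K x -> enorm (M *m x + b) <= 1.

(** A minimal ellipsoid seen as the preimage of the ball: its volume is inversely proportional to
    [|\det M|]. *)
Definition extremal_map n (K : set 'cV[R]_n) (M : 'M[R]_n) (b : 'cV[R]_n) :=
  [/\ M \in unitmx, maps_into_ball K M b &
    forall M' b', M' \in unitmx -> maps_into_ball K M' b' ->
      `|\det M'| <= `|\det M|].

(** The parallelogram law at the two image points; the gain is a quarter of the squared distance
    between them. *)
Lemma maps_into_ball_midpoint n (K : set 'cV[R]_n) M1 b1 M2 b2 (Q : 'M[R]_n) x :
  (forall y, sqnorm (Q *m y) = sqnorm y) ->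
  maps_into_ball K M1 b1 -> maps_into_ball K M2 b2 -> K x ->
  sqnorm (2^-1 *: (M1 + Q *m M2) *m x + 2^-1 *: (b1 + Q *m b2)) <=
  1 - 4^-1 * sqnorm ((M1 - Q *m M2) *m x + (b1 - Q *m b2)).
Proof.
move=> QQ K1 K2 Kx; set y := M1 *m x + b1; set z := Q *m (M2 *m x + b2).
have -> : 2^-1 *: (M1 + Q *m M2) *m x + 2^-1 *: (b1 + Q *m b2) = 2^-1 *: (y + z).
  by rewrite -scalemxAl -scalerDr mulmxDl addrACA -mulmxA -mulmxDr.
have -> : (M1 - Q *m M2) *m x + (b1 - Q *m b2) = y - z.
  by rewrite mulmxBl addrACA -opprD -mulmxA -mulmxDr.
rewrite sqnorm_midpoint lerB// QQ.
by have := K1 _ Kx; have := K2 _ Kx; rewrite !euclidean_norm_le1 -/y; lra.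
Qed.

Lemma extremal_map_det n (K : set 'cV[R]_n) M1 b1 M2 b2 :
  extremal_map K M1 b1 -> extremal_map K M2 b2 -> `|\det M1| = `|\det M2|.
Proof.
move=> [u1 K1 m1] [u2 K2 m2]; apply/eqP; rewrite eq_le.
by rewrite (m2 _ b1)// (m1 _ b2).
Qed.

(** Composing with an orthogonal map on the left preserves extremality, so only the norm of the
    image, hence the ellipsoid, can be unique. *)
Lemma extremal_map_unique n (K : set 'cV[R]_n) M1 b1 M2 b2 :
  extremal_map K M1 b1 -> extremal_map K M2 b2 ->
  forall x, enorm (M1 *m x + b1) = enorm (M2 *m x + b2).
Proof.
move=> e1 e2; have d12 := extremal_map_det e1 e2.
case: e1 e2 => [u1 K1 m1] [u2 K2 _].
have det1 : 0 < `|\det M1| by rewrite normr_gt0 -unitfE -unitmxE.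
pose N := M2 *m invmx M1.
have uN : N \in unitmx by rewrite unitmx_mul u2 unitmx_inv.
have detN : `|\det N| = 1.
  by rewrite det_mulmx det_inv normrM normfV -d12 divff// gt_eqF.
have NM : N *m M1 = M2 by rewrite mulmxKV.
(* If [N] changed the norm of some [x], the half sum of [M1] and a suitable [Q M2] would still send
   [K] into the ball, with a larger determinant. *)
have isoN x : sqnorm (N *m x) = sqnorm x.
  apply/eqP; apply: contraT => Nx.
  have [Q QQ hQ] := exists_rotation_det_strict uN Nx.
  rewrite detN mulr1 in hQ.
  pose M3 := 2^-1 *: (M1 + Q *m M2).
  have det3 : \det M3 ^+ 2 = (4 ^+ n)^-1 * \det (1%:M + Q *m N) ^+ 2 * `|\det M1| ^+ 2.
    rewrite /M3 detZ -NM mulmxA -{1}[M1]mul1mx -mulmxDl det_mulmx !exprMn.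
    have -> : (4 ^+ n)^-1 = (2^-1 ^+ n) ^+ 2 :> R.
      by rewrite exprAC -exprVn; congr (_ ^+ _); field.
    by rewrite real_normK ?num_real// mulrA.
  have lt13 : `|\det M1| < `|\det M3|.
    rewrite -(ltr_pXn2r (n := 2))// ?nnegrE// [ltRHS]real_normK ?num_real// det3.
    by rewrite ltr_pMl ?exprn_gt0// mulrC ltr_pdivlMr ?mul1r// exprn_gt0.
  have u3 : M3 \in unitmx.
    by rewrite unitmxE unitfE -normr_gt0 (lt_trans det1 lt13).
  have h3 : maps_into_ball K M3 (2^-1 *: (b1 + Q *m b2)).
    move=> y Ky; rewrite euclidean_norm_le1.
    apply: le_trans (maps_into_ball_midpoint (fun z => sqnorm_orthogonal z QQ) K1 K2 Ky) _.
    by rewrite gerBl mulr_ge0// sqnorm_ge0.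
  by have := m1 _ _ u3 h3; rewrite leNgt lt13.
have isoV y : sqnorm (invmx N *m y) = sqnorm y by rewrite -isoN mulKVmx.
have VM2 : invmx N *m M2 = M1 by rewrite -NM mulKmx.
have V x : sqnorm (M2 *m x + b2) = sqnorm (M1 *m x + invmx N *m b2).
  by rewrite -isoV mulmxDr mulmxA VM2.
have [bE|bD] := eqVneq b1 (invmx N *m b2).
  by move=> x; congr (Num.sqrt _); rewrite -/(sqnorm _) -/(sqnorm _) V bE.
(* Distinct translation parts exclude dimension 0, so a dilation by [s > 1] does increase the
   determinant. *)
have n0 : (0 < n)%N.
  rewrite lt0n; apply: contra bD => /eqP n0; apply/eqP/colP => -[i ilt].
  by exfalso; move: ilt; rewrite n0.
pose dl := 4^-1 * sqnorm (b1 - invmx N *m b2).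
have dl0 : 0 < dl.
  by rewrite mulr_gt0// lt0r sqnorm_ge0 sqnorm_eq0 subr_eq0 bD.
(* The averaged map has squared norm at most [1 - dl] on [K], and [(1 + dl) (1 - dl) <= 1], so
   dilating it by [s] keeps [K] in the ball. *)
pose s := Num.sqrt (1 + dl).
have s1 : 1 < s by rewrite -[ltLHS](@sqrtr1 R) ltr_sqrt ?ltrDl// addr_gt0.
have s0 : 0 < s by apply: lt_trans s1.
have := m1 (s *: M1) (s *: (2^-1 *: (b1 + invmx N *m b2))).
rewrite unitmxZ ?unitfE ?gt_eqF// => /(_ u1).
rewrite detZ normrM normrX (gtr0_norm s0) leNgt ltr_pMl// exprn_egt1 ?lt0n_neq0//.
have h : maps_into_ball K (s *: M1) (s *: (2^-1 *: (b1 + invmx N *m b2))).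
  move=> x Kx; rewrite euclidean_norm_le1 -scalemxAl -scalerDr sqnormZ.
  have := maps_into_ball_midpoint isoV K1 K2 Kx.
  rewrite VM2 subrr mul0mx add0r -/dl -mulr2n -[M1 *+ 2]scaler_nat scalerA mulVf// scale1r.
  rewrite sqr_sqrtr ?addr_ge0 ?(ltW dl0)// => h.
  apply: le_trans (ler_wpM2l _ h) _; first by rewrite addr_ge0 ?(ltW dl0).
  by have := sqr_ge0 dl; rewrite -subr_ge0 => ?; lra.
by move=> /(_ h).
Qed.

End extremal_affine_maps.

(** * Existence of extremal maps by compactness *)

Section extremal_map_existence.
Variable R : realType.
Local Notation enorm := (@euclidean_norm R _).

Lemma continuous_bigsum (X : topologicalType) (I : Type) (s : seq I) (f : I -> X -> R) :
  (forall i, continuous (f i)) -> continuous (fun x => \sum_(i <- s) f i x).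
Proof.
move=> cf x; elim: s => [|i s IH].
  by under eq_fun do rewrite big_nil; exact: cvg_cst.
by under eq_fun do rewrite big_cons; apply: cvgD IH; exact: cf.
Qed.

Lemma continuous_bigprod (X : topologicalType) (I : Type) (s : seq I) (f : I -> X -> R) :
  (forall i, continuous (f i)) -> continuous (fun x => \prod_(i <- s) f i x).
Proof.
move=> cf x; elim: s => [|i s IH].
  by under eq_fun do rewrite big_nil; exact: cvg_cst.
by under eq_fun do rewrite big_cons; apply: cvgM IH; exact: cf.
Qed.

Lemma continuous_det (X : topologicalType) n (A : X -> 'M[R]_n) :
  (forall i j, continuous (fun x => A x i j)) -> continuous (fun x => \det (A x)).
Proof.
move=> cA; apply: continuous_bigsum => s x; apply: cvgM; first exact: cvg_cst.
by apply: continuous_bigprod.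
Qed.

Lemma continuous_sqnorm_affine (X : topologicalType) n (A : X -> 'M[R]_n)
    (b : X -> 'cV[R]_n) y :
  (forall i j, continuous (fun x => A x i j)) ->
  (forall i, continuous (fun x => b x i 0)) ->
  continuous (fun x => sqnorm (A x *m y + b x)).
Proof.
move=> cA cb; apply: continuous_bigsum => i.
have cg : continuous (fun x => \sum_j A x i j * y j 0 + b x i 0).
  move=> x; apply: cvgD; last exact: cb.
  apply: (@continuous_bigsum _ _ _ (fun j x => A x i j * y j 0)) => j {}x.
  by apply: cvgM; [exact: cA|exact: cvg_cst].
rewrite (_ : (fun _ => _) = (fun x => (\sum_j A x i j * y j 0 + b x i 0) ^+ 2)).
  by move=> x; under eq_fun do rewrite expr2; apply: cvgM; exact: cg.
by apply/funext => x; rewrite !mxE.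
Qed.

Lemma ler_entry_norm m n (A : 'M[R]_(m, n)) i j : `|A i j| <= `|A|.
Proof.
rewrite [leRHS]/Num.norm /= mx_normrE.
exact: (le_bigmax _ (fun ij => `|A ij.1 ij.2|) (i, j)).
Qed.

Lemma mx_norm_le m n (A : 'M[R]_(m, n)) c :
  0 <= c -> (forall i j, `|A i j| <= c) -> `|A| <= c.
Proof.
move=> c0 Ac; rewrite [leLHS]/Num.norm /= mx_normrE.
by apply/bigmax_leP; split.
Qed.

(** The images of an interior point and of its shifts along the axes lie in the unit ball; their
    differences control the columns of [M], and then [b] is controlled as well. *)
Lemma maps_into_ball_entries n (K : set 'cV[R]_n) : K° !=set0 ->
  exists2 C, 0 <= C & forall M b, maps_into_ball K M b ->
    (forall i j, `|M i j| <= C) /\ (forall i, `|b i 0| <= C).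
Proof.
move=> [x0 /nbhs_ballP[e /= e0 eK]].
have Kx0 : K x0 by apply: eK; exact: ballxx.
have Kd j : K (x0 + (e / 2) *: delta_mx j 0).
  apply: eK; rewrite mx_norm_ball /ball_ /= opprD addNKr normrN.
  apply: (@le_lt_trans _ _ (e / 2)); last by rewrite ltr_pdivrMr// ltr_pMr// ltr1n.
  apply: mx_norm_le; first by rewrite divr_ge0// ltW.
  move=> i k; rewrite !mxE normrM ger0_norm ?divr_ge0 ?(ltW e0)//.
  by rewrite ler_piMr ?divr_ge0 ?(ltW e0)//; case: (_ && _); rewrite ?normr1 ?normr0.
(* Coordinates of two points of the unit ball differ by at most 2, and here they differ by [e / 2]
   times an entry of [M]. *)
pose B := 4 / e; have B0 : 0 <= B by rewrite divr_ge0// ltW.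
have S0 : 0 <= \sum_j `|x0 j 0| by rewrite sumr_ge0.
(* The term [B] covers the entries of [M]; the other two bound [b] as the difference of [M x0 + b]
   and [M x0]. *)
exists (1 + B + B * \sum_j `|x0 j 0|); first by rewrite !addr_ge0// mulr_ge0.
move=> M b KM.
have Mb i : `|(M *m x0 + b) i 0| <= 1.
  by apply: le_trans (ler_coord_euclidean_norm _ _) _; exact: KM.
have MB i j : `|M i j| <= B.
  have := KM _ (Kd j) => /(le_trans (ler_coord_euclidean_norm _ i)).
  rewrite mulmxDr addrAC mxE -scalemxAr -colE [X in _ + X]mxE [X in _ * X]mxE => h.
  have : `|e / 2 * M i j| <= 2.
    have -> : e / 2 * M i j = (M *m x0 + b) i 0 + e / 2 * M i j - (M *m x0 + b) i 0.
      by rewrite addrAC subrr add0r.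
    by apply: le_trans (ler_normB _ _) _; have := Mb i; lra.
  rewrite normrM ger0_norm ?divr_ge0 ?(ltW e0)// /B ler_pdivlMr//; lra.
split=> [i j|i].
  by apply: le_trans (MB i j) _; rewrite -addrA addrCA lerDl addr_ge0// mulr_ge0.
have -> : b i 0 = (M *m x0 + b) i 0 - (M *m x0) i 0.
  by rewrite [in X in X - _]mxE addrAC subrr add0r.
apply: le_trans (ler_normB _ _) _; rewrite -addrA; apply: lerD; first exact: Mb.
rewrite ler_wpDl// mxE; apply: le_trans (ler_norm_sum _ _ _) _.
rewrite mulr_sumr; apply: ler_sum => j _; rewrite normrM.
by rewrite ler_wpM2r.
Qed.

(** A small homothety works; it supplies a competitor of nonzero determinant. *)
Lemma bounded_maps_into_ball n (K : set 'cV[R]_n) : compact K ->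
  exists2 M : 'M[R]_n, M \in unitmx & maps_into_ball K M 0.
Proof.
move=> /compact_bounded/ex_strict_bound_gt0[B B0 KB].
(* On [K] the squared norm is at most [B^2 (n + 1)], which is at most the inverse square of [s]. *)
pose s := (B * n.+1%:R)^-1.
have s0 : 0 < s by rewrite invr_gt0 mulr_gt0.
exists s%:M; first by rewrite unitmxE det_scalar unitrX// unitfE gt_eqF.
move=> x /KB /= xB; rewrite addr0 mul_scalar_mx euclidean_norm_le1 sqnormZ.
have : sqnorm x <= B ^+ 2 * n.+1%:R.
  apply: (@le_trans _ _ (\sum_(i < n) B ^+ 2)).
    apply: ler_sum => i _; rewrite -real_normK ?num_real// lerXn2r ?nnegrE ?(ltW B0)//.
    by apply: le_trans (ler_entry_norm x i 0) (ltW xB).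
  rewrite sumr_const card_ord -[_ *+ n]mulr_natr.
  by apply: ler_wpM2l; rewrite ?sqr_ge0// ler_nat.
move=> h; apply: le_trans (ler_wpM2l (sqr_ge0 s) h) _.
rewrite /s exprVn exprMn ler_pdivrMl ?mulr_gt0 ?exprn_gt0// mulr1.
by rewrite ler_wpM2l ?sqr_ge0// -natrX ler_nat expnS expn1 leq_pmulr.
Qed.

Lemma extremal_map_exists n (K : set 'cV[R]_n) : compact K -> K° !=set0 ->
  exists M b, extremal_map K M b.
Proof.
move=> cK iK.
(* A pair [(M, b)] is flattened into one row vector, so that bounded closed sets of pairs are
   compact. *)
pose mx (p : 'rV[R]_(n * (n + 1))) : 'M[R]_n := lsubmx (vec_mx p).
pose vc (p : 'rV[R]_(n * (n + 1))) : 'cV[R]_n := rsubmx (vec_mx p).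
have cmx i j : continuous (fun p => mx p i j).
  under eq_fun do rewrite !mxE; exact: coord_continuous.
have cvc i : continuous (fun p => vc p i 0).
  under eq_fun do rewrite !mxE; exact: coord_continuous.
pose S := [set p | maps_into_ball K (mx p) (vc p)].
have pair M b : exists p, mx p = M /\ vc p = b.
  by exists (mxvec (row_mx M b)); rewrite /mx /vc mxvecK row_mxKl row_mxKr.
have [M0 u0 h0] := bounded_maps_into_ball cK.
have cS : compact S.
  apply: bounded_closed_compact.
    have [C C0 hC] := maps_into_ball_entries iK.
    exists C; split; first exact: num_real.
    move=> y Cy; change (forall p : 'rV[R]_(n * (n + 1)), S p -> `|p| <= y).
    move=> p /hC[hM hb]; apply: mx_norm_le; first by rewrite (le_trans C0)// ltW.
    move=> i j; rewrite ord1; apply: le_trans (ltW Cy).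
    case/mxvec_indexP: j => i' j.
    case: (split_ordP j) => k ->.
      by have := hM i' k; rewrite /mx !mxE.
    by have := hb i'; rewrite /vc !mxE ord1.
  rewrite (_ : S = \bigcap_(x in K)
      (fun p => sqnorm (mx p *m x + vc p)) @^-1` [set y | y <= 1]).
    apply: closed_bigI => x _; apply: preimage_closed; last exact: closed_le.
    by move=> p _; exact: continuous_sqnorm_affine.
  by apply/seteqP; split => p /= h x Kx; have := h x Kx; rewrite /= euclidean_norm_le1.
have [p0 [p0M p0b]] := pair M0 0.
have Sp0 : S p0 by rewrite /S /= p0M p0b.
have [p pS pmax] : exists2 p, p \in S &
    forall q, q \in S -> `|\det (mx q)| <= `|\det (mx p)|.
  apply: compact_EVT_max => //; first by exists p0.
  apply: continuous_subspaceT => q.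
  apply: (@continuous_comp _ _ _ (fun q => \det (mx q)) Num.norm).
    exact: continuous_det.
  exact: norm_continuous.
exists (mx p), (vc p); split; last 2 first.
- by move: pS; rewrite inE.
- move=> M b uM KM; have [q] := pair M b.
  by move=> [pM pb]; rewrite -pM; apply: pmax; rewrite inE /S /= pM pb.
(* The maximum is at least the nonzero determinant of the homothety, so the maximizer is
   invertible. *)
have := pmax p0; rewrite inE p0M => /(_ Sp0) h.
by rewrite unitmxE unitfE -normr_gt0 (lt_le_trans _ h)// normr_gt0 -unitfE -unitmxE.
Qed.

End extremal_map_existence.

(** * From extremal maps to the Löwner ellipsoid and function *)

Section loewner.
Variable R : realType.
Local Notation enorm := (@euclidean_norm R _).

Lemma euclidean_normZ n (a : R) (x : 'cV[R]_n) :
  0 <= a -> enorm (a *: x) = a * enorm x.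
Proof.
move=> a0; rewrite /euclidean_norm -/(sqnorm _) -/(sqnorm _) sqnormZ.
by rewrite sqrtrM ?sqr_ge0// sqrtr_sqr ger0_norm.
Qed.

(** The image of the ball under an affine bijection is its preimage under the inverse, whose linear
    part is [invmx M]. *)
Lemma is_ellipsoidE n (E : set 'cV[R]_n) : is_ellipsoid E <->
  exists M b, M \in unitmx /\ E = [set x | enorm (M *m x + b) <= 1].
Proof.
split=> [[A [M [b [uM ->]]] ->]|[M [b [uM ->]]]].
  exists (invmx M), (- (invmx M *m b)); split; first by rewrite unitmx_inv.
  apply/seteqP; split => [_ [x /= x1 <-]|x /= x1].
    by rewrite mulmxDr mulKmx// addrK.
  by exists (invmx M *m x - invmx M *m b) => //; rewrite -mulmxBr mulKVmx// subrK.
exists (fun x => invmx M *m x + (- (invmx M *m b))).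
  by exists (invmx M), (- (invmx M *m b)); rewrite unitmx_inv.
apply/seteqP; split => [x /= x1|_ [x /= x1 <-]].
  by exists (M *m x + b) => //; rewrite mulmxDr mulKmx// addrK.
by rewrite -mulmxBr mulKVmx// subrK.
Qed.

Lemma is_loewner_ellipsoidE n (K E : set 'cV[R]_n) :
  is_loewner_ellipsoid K E <->
  exists M b, extremal_map K M b /\ E = [set x | enorm (M *m x + b) <= 1].
Proof.
have [v v0 vE] := volume_affine_ball R n.
have le_vol (M M' : 'M[R]_n) b b' : M \in unitmx -> M' \in unitmx ->
    (volume [set x | (enorm (M *m x + b) <= 1)%R] <=
     volume [set x | (enorm (M' *m x + b') <= 1)%R])%E = (`|\det M'| <= `|\det M|).
  move=> uM uM'; rewrite !vE// lee_fin ler_pM2l// lef_pV2// posrE normr_gt0.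
    by rewrite -unitfE -unitmxE.
  by rewrite -unitfE -unitmxE.
split=> [[/is_ellipsoidE[M [b [uM ->]]] KE minE]|[M [b [[uM KM maxM] ->]]]].
  exists M, b; split=> //; split=> // M' b' uM' KM'.
  rewrite -(le_vol _ _ b b')//; apply: minE => //.
  by apply/is_ellipsoidE; exists M', b'.
split=> //; first by apply/is_ellipsoidE; exists M, b.
by move=> _ /is_ellipsoidE[M' [b' [uM' ->]]] KM'; rewrite le_vol// (maxM _ b').
Qed.

(** The extremal map rules out the default value of [xget]; by uniqueness, the ellipsoid chosen does
    not depend on the map. *)
Lemma loewner_ellipsoid_extremal n (K : set 'cV[R]_n) M b : extremal_map K M b ->
  loewner_ellipsoid K = [set x | enorm (M *m x + b) <= 1].
Proof.
move=> eM; rewrite /loewner_ellipsoid.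
have /(xgetPex set0) : exists E, is_loewner_ellipsoid K E.
  by exists [set x | enorm (M *m x + b) <= 1]; apply/is_loewner_ellipsoidE; exists M, b.
move=> /is_loewner_ellipsoidE[M' [b' [eM' ->]]].
by apply/seteqP; split => x /=; rewrite (extremal_map_unique eM eM').
Qed.

(** Only the points of [K] give a constraint, since the cone is positive everywhere and the
    indicator vanishes outside [K]. *)
Lemma indic_le_exp_cone n (K : set 'cV[R]_n) A t :
  (forall x, (\1_K x : R) <= exp_cone A t x) <-> (forall x, K x -> enorm (A x) <= t).
Proof.
split=> [h x Kx|h x].
  have := h x; rewrite indicE mem_set// /exp_cone -{1}expR0 ler_expR /=.
  by rewrite addrC subr_ge0.
rewrite indicE; have [|_] := boolP (x \in K); last by rewrite expR_ge0.
by rewrite inE => /h xt; rewrite /exp_cone -{1}expR0 ler_expR addrC subr_ge0.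
Qed.

(** The condition [s * t <= 1] covers both the normalization [s = t^-1] and arbitrarily large [s]
    when [t <= 0]. *)
Lemma maps_into_ballZ n (K : set 'cV[R]_n) (M : 'M[R]_n) b (s t : R) :
  0 <= s -> s * t <= 1 -> (forall x, K x -> enorm (M *m x + b) <= t) ->
  maps_into_ball K (s *: M) (s *: b).
Proof.
move=> s0 st h x Kx; rewrite -scalemxAl -scalerDr euclidean_normZ//.
by apply: le_trans (ler_wpM2l s0 (h x Kx)) st.
Qed.

Lemma normr_detZ n (M : 'M[R]_n) (s : R) :
  0 <= s -> `|\det (s *: M)| = s ^+ n * `|\det M|.
Proof. by move=> s0; rewrite detZ normrM normrX ger0_norm. Qed.

(** * Optimal height and level set in positive dimension *)

Section positive_dimension.
Variables (n : nat) (K : set 'cV[R]_n) (M0 : 'M[R]_n) (b0 : 'cV[R]_n).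
Hypotheses (n0 : (0 < n)%N) (e0 : extremal_map K M0 b0).

Local Notation D := `|\det M0|.
Let D0 : 0 < D.
Proof. by case: e0 => u0 _ _; rewrite normr_gt0 -unitfE -unitmxE. Qed.

(* If t <= 0, then K is sent into the unit ball by all the dilates of the map. *)
Lemma admissible_height_gt0 M b t : M \in unitmx ->
  (forall x, K x -> enorm (M *m x + b) <= t) -> 0 < t.
Proof.
move=> uM h; rewrite ltNge; apply/negP => t0.
have dM : 0 < `|\det M| by rewrite normr_gt0 -unitfE -unitmxE.
(* Chosen so that [s |\det M|] exceeds [D]; since [s >= 1] and [n > 0], the factor [s ^+ n] is at
   least [s]. *)
pose s := 1 + D / `|\det M|.
have s1 : 1 <= s by rewrite lerDl divr_ge0.
have s0 : 0 < s by apply: lt_le_trans s1.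
have hs : maps_into_ball K (s *: M) (s *: b).
  by apply: maps_into_ballZ h; [exact: ltW|rewrite (le_trans (mulr_ge0_le0 _ t0))// ltW].
have us : s *: M \in unitmx by rewrite unitmxZ ?unitfE ?gt_eqF.
case: (e0) => _ _ /(_ _ _ us hs).
rewrite normr_detZ ?(ltW s0)// leNgt => /negP; apply.
apply: (@lt_le_trans _ _ (s * `|\det M|)).
  by rewrite /s mulrDl mul1r divfK ?gt_eqF// ltrDr.
by rewrite ler_pM2r// -[leLHS]expr1 ler_weXn2l.
Qed.

(** Dividing the map by [t] makes it a competitor of the extremal map. *)
Lemma admissible_det_le M b t : M \in unitmx ->
  (forall x, K x -> enorm (M *m x + b) <= t) -> `|\det M| <= t ^+ n * D.
Proof.
move=> uM h; have t0 := admissible_height_gt0 uM h.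
have hs : maps_into_ball K (t^-1 *: M) (t^-1 *: b).
  by apply: maps_into_ballZ h; [rewrite invr_ge0 ltW|rewrite mulVf// gt_eqF].
have us : t^-1 *: M \in unitmx by rewrite unitmxZ ?unitfE ?invr_eq0 ?gt_eqF.
case: (e0) => _ _ /(_ _ _ us hs).
by rewrite normr_detZ ?invr_ge0 ?(ltW t0)// exprVn ler_pdivrMl// exprn_gt0.
Qed.

(** With [t = n (1 + s)] this is the [n]-th power of [1 + s <= expR s], where equality forces
    [s = 0]. *)
Lemma expR_height_ge t : 0 < t ->
  expR n%:R * t ^+ n <= expR t * n%:R ^+ n ?= iff (t == n%:R :> R).
Proof.
move=> t0; have nR0 : 0 < n%:R :> R by rewrite ltr0n.
pose s := t / n%:R - 1.
have tE' : t = (1 + s) * n%:R by rewrite /s addrC subrK divfK ?gt_eqF.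
have tE : t = n%:R + s *+ n by rewrite [LHS]tE' mulrDl mul1r mulr_natr.
have s1 : 0 <= 1 + s by rewrite /s addrC subrK divr_ge0// ltW.
have -> : expR t = expR n%:R * expR s ^+ n.
  by rewrite [in LHS]tE expRD -[s *+ n]mulr_natr expRM_natr.
have -> : t ^+ n = (1 + s) ^+ n * n%:R ^+ n by rewrite [in LHS]tE' exprMn.
split.
  rewrite -mulrA ler_pM2l ?expR_gt0// ler_pM2r ?exprn_gt0//.
  by rewrite lerXn2r ?nnegrE ?expR_ge0// expR_ge1Dx.
have -> : (t == n%:R) = (s == 0).
  by rewrite -[LHS]subr_eq0 [in LHS]tE addrAC subrr add0r mulrn_eq0 eqn0Ngt n0.
rewrite -mulrA; have [->|sD] := eqVneq s 0.
  by rewrite addr0 expR0 eqxx.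
apply: lt_eqF; rewrite ltr_pM2l ?expR_gt0// ltr_pM2r ?exprn_gt0//.
by rewrite ltr_pXn2r ?nnegrE ?expR_ge0// expR_gt1Dx.
Qed.

(** The integral [c e^t / |\det M|] of any competitor is at least [c e^t / (t^n D)] by the
    determinant bound, hence at least [c e^n / (n^n D)], the value at the given cone. *)
Lemma extremal_is_loewner_function :
  is_loewner_function (\1_K : 'cV[R]_n -> R)
    (exp_cone (fun x => (n%:R *: M0) *m x + n%:R *: b0) n%:R).
Proof.
have [c c0 cE] := integral_exp_cone R n.
case: (e0) => u0 K0 _.
have nR0 : 0 < n%:R :> R by rewrite ltr0n.
have un : n%:R *: M0 \in unitmx by rewrite unitmxZ ?unitfE ?gt_eqF.
exists (fun x => (n%:R *: M0) *m x + n%:R *: b0), n%:R; split=> //.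
  split; first by exists (n%:R *: M0), (n%:R *: b0).
  apply/indic_le_exp_cone => x Kx; rewrite -scalemxAl -scalerDr euclidean_normZ//.
  by rewrite ger_pMr// K0.
move=> _ t [[M [b [uM ->]]]] /indic_le_exp_cone h.
have t0 := admissible_height_gt0 uM h.
have dM : 0 < `|\det M| by rewrite normr_gt0 -unitfE -unitmxE.
rewrite !cE// lee_fin -!mulrA ler_pM2l// normr_detZ//.
rewrite ler_pdivrMr ?mulr_gt0 ?exprn_gt0// mulrAC ler_pdivlMr//.
apply: le_trans (ler_wpM2l (expR_ge0 _) (admissible_det_le uM h)) _.
by rewrite !mulrA ler_pM2r// (expR_height_ge t0).
Qed.

Lemma loewner_function_level L : is_loewner_function (\1_K : 'cV[R]_n -> R) L ->
  [set x | 1 <= L x] = loewner_ellipsoid K.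
Proof.
have [c c0 cE] := integral_exp_cone R n.
case: (e0) => u0 K0 max0.
have nR0 : 0 < n%:R :> R by rewrite ltr0n.
have un : n%:R *: M0 \in unitmx by rewrite unitmxZ ?unitfE ?gt_eqF.
move=> [_ [t [[[M [b [uM ->]]] /indic_le_exp_cone h] minL ->]]].
have t0 := admissible_height_gt0 uM h.
have dM : 0 < `|\det M| by rewrite normr_gt0 -unitfE -unitmxE.
(* Minimality against the cone of height [n] built on [M0], with denominators cleared. *)
have : expR t * (n%:R ^+ n * D) <= expR n%:R * `|\det M|.
  have := minL (fun x => (n%:R *: M0) *m x + n%:R *: b0) n%:R.
  rewrite !cE// lee_fin -!mulrA ler_pM2l// normr_detZ//.
  rewrite ler_pdivrMr// mulrAC ler_pdivlMr ?mulr_gt0 ?exprn_gt0//; apply.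
  split; first by exists (n%:R *: M0), (n%:R *: b0).
  apply/indic_le_exp_cone => x Kx; rewrite -scalemxAl -scalerDr euclidean_normZ//.
  by rewrite ger_pMr// K0.
move=> le1.
(* Together with the determinant bound, [le1] reverses [expR_height_ge], so its equality case
   applies. *)
have tn : t = n%:R.
  apply/eqP; rewrite -(expR_height_ge t0) eq_le (expR_height_ge t0) /=.
  rewrite -(ler_pM2r D0) -!mulrA; apply: le_trans le1 _.
  by rewrite ler_pM2l ?expR_gt0//; exact: admissible_det_le uM h.
rewrite (@loewner_ellipsoid_extremal _ _ (t^-1 *: M) (t^-1 *: b)).
  apply/funext => x /=; rewrite /exp_cone -{1}expR0 ler_expR addrC subr_ge0.
  rewrite -scalemxAl -scalerDr euclidean_normZ ?invr_ge0 ?(ltW t0)//.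
  by rewrite ler_pdivrMl// mulr1.
split.
- by rewrite unitmxZ ?unitfE ?invr_eq0 ?gt_eqF.
- by apply: maps_into_ballZ h; [rewrite invr_ge0 ltW|rewrite mulVf// gt_eqF].
(* Once [t = n], the inequality [le1] says that [t^-1 M] has a determinant at least [D] in absolute
   value. *)
- move=> M' b' uM' KM'; apply: le_trans (max0 _ _ uM' KM') _.
  rewrite normr_detZ ?invr_ge0 ?(ltW t0)// exprVn ler_pdivlMl ?exprn_gt0//.
  by move: le1; rewrite tn ler_pM2l ?expR_gt0.
Qed.

End positive_dimension.
End loewner.

Theorem mainTheorem2 (R : realType) (n : nat) (K : set 'cV[R]_n) :
  convex_body K ->
  [set x : 'cV[R]_n | 1 <= loewner_function (\1_K : 'cV[R]_n -> R) x] =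
  loewner_ellipsoid K.
Proof.
move=> [_ cK iK]; have [M0 [b0 e0]] := extremal_map_exists cK iK.
(* Dilations do not change determinants in dimension 0, so that case is separate: the space is one
   point, [K] is all of it, and both sides are [setT]. *)
have [n0|n0] := posnP n; last first.
  apply: (loewner_function_level n0 e0); rewrite /loewner_function.
  apply: (xgetPex (cst 1) (P := is_loewner_function _)).
  by eexists; exact: extremal_is_loewner_function n0 e0.
have eqR x y : x = y :> 'cV[R]_n.
  by apply/colP => -[i ilt]; exfalso; move: ilt; rewrite n0.
have [x0 Kx0] : K !=set0 by have [x /interior_subset Kx] := iK; exists x.
have KT x : K x by rewrite (eqR x x0).
have -> : loewner_ellipsoid K = setT.
  rewrite (loewner_ellipsoid_extremal e0) -subTset => x _.
  by case: e0 => _ + _; apply.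
rewrite -subTset => x _ /=; rewrite /loewner_function.
(* A Löwner function dominates the indicator, which is 1 at [x]; the default value is the constant
   1. The level set contains [x] either way. *)
case: xgetP => [L _ [A [t [[_ /(_ x)]]]]|_ //].
by rewrite indicE mem_set// => ? _ ->.
Qed.
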